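(* Let $Q,R$ be finite quandles. Then $$\dim_{Q\times R}=\dim_Q\cdot\dim_R.$$
   Context: A quandle is a set $Q$ with a binary operation $(x,y)\mapsto {}^{x}y$ such that (Q1) ${}^{x}x=x$ for all $x$; (Q2) for every $x$ the map $\varphi_x\colon Q\to Q$, $\varphi_x(y)={}^{x}y$, is a bijection; (Q3) ${}^{x}({}^{y}z)={}^{({}^{x}y)}({}^{x}z)$ for all $x,y,z$. A sub-quandle $R\le Q$ is a subset (possibly empty) closed under the operation. $\mathrm{Inn}(Q)$ is the group of automorphisms of $Q$ generated by all $\varphi_x$, $x\in Q$, and $\pi_0(Q)=Q/\mathrm{Inn}(Q)$ is its set of orbits in $Q$. For a finite quandle $Q$, $\dim_Q=\max_{R\le Q}|\pi_0(R)|$, the maximum over all sub-quandles $R$ of $Q$ (with $\pi_0(R)=R/\mathrm{Inn}(R)$). The product quandle $Q\times R$ has operation ${}^{(x,y)}(x',y')=({}^{x}x',{}^{y}y')$. *)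

(* Defs.v *)
From HB Require Import structures.
From mathcomp Require Import all_boot all_fingroup.

Set Implicit Arguments.
Unset Strict Implicit.
Unset Printing Implicit Defensive.

Reserved Notation "x |> y" (at level 35, right associativity).

HB.mixin Record isQuandle (Q : Type) := {
  qop : Q -> Q -> Q;
  qopxx : forall x, qop x x = x;
  qop_bij : forall x, bijective (qop x);
  qopD : forall x y z, qop x (qop y z) = qop (qop x y) (qop x z)
}.

#[short(type="quandleType")]
HB.structure Definition Quandle := {Q of isQuandle Q}.

#[short(type="finQuandleType")]
HB.structure Definition FinQuandle := {Q of Finite Q & isQuandle Q}.

Notation "x |> y" := (qop x y).

Section ProdQuandle.
Variables Q R : quandleType.
Implicit Types u v w : Q * R.

Definition prod_qop u v : Q * R := (u.1 |> v.1, u.2 |> v.2).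

Lemma prod_qopxx u : prod_qop u u = u.
Proof. by case: u => x y; rewrite /prod_qop /= !qopxx. Qed.

Lemma prod_qop_bij u : bijective (prod_qop u).
Proof.
have [f fK Kf] := qop_bij u.1; have [g gK Kg] := qop_bij u.2.
exists (fun v => (f v.1, g v.2)) => -[x y]; first by rewrite /= fK gK.
by rewrite /prod_qop /= Kf Kg.
Qed.

Lemma prod_qopD u v w :
  prod_qop u (prod_qop v w) = prod_qop (prod_qop u v) (prod_qop u w).
Proof. by congr (_, _); apply: qopD. Qed.

HB.instance Definition _ :=
  isQuandle.Build (Q * R)%type prod_qopxx prod_qop_bij prod_qopD.
End ProdQuandle.

HB.instance Definition _ (Q R : finQuandleType) :=
  Quandle.on (Q * R)%type.

Section Subquandle.
Variable Q : finQuandleType.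

Definition qclosed (S : {set Q}) : bool :=
  [forall x in S, forall y in S, x |> y \in S].

Record subquandle := Subquandle {
  sq_set :> {set Q};
  sq_closed : qclosed sq_set
}.

HB.instance Definition _ := [isSub for sq_set].
HB.instance Definition _ := [Finite of subquandle by <:].

Variable S : subquandle.

Definition sq_carrier : Type := {x : Q | x \in sq_set S}.
HB.instance Definition _ := SubFinite.on sq_carrier.
Implicit Types x y z : sq_carrier.

Lemma sq_op_subproof x y : val x |> val y \in sq_set S.
Proof.
by move/forall_inP: (sq_closed S) => /(_ _ (valP x)) /forall_inP /(_ _ (valP y)).
Qed.

Definition sq_op x y : sq_carrier := Sub (val x |> val y) (sq_op_subproof x y).

Lemma sq_opxx x : sq_op x x = x.
Proof. by apply: val_inj; rewrite /= qopxx. Qed.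

(* Since Q is finite, closure under the operation makes the restricted translations bijective. *)
Lemma sq_op_bij x : bijective (sq_op x).
Proof.
apply: injF_bij => y z /(congr1 val) /= eq_yz; apply: val_inj.
exact: bij_inj (qop_bij (val x)) _ _ eq_yz.
Qed.

Lemma sq_opD x y z : sq_op x (sq_op y z) = sq_op (sq_op x y) (sq_op x z).
Proof. by apply: val_inj; rewrite /= qopD. Qed.

HB.instance Definition _ := isQuandle.Build sq_carrier sq_opxx sq_op_bij sq_opD.
End Subquandle.

Definition qperm (Q : finQuandleType) (x : Q) : {perm Q} :=
  perm (bij_inj (qop_bij x)).

Definition Inn (Q : finQuandleType) : {group {perm Q}} :=
  <<[set qperm x | x : Q]>>%G.

Definition pi0 (Q : finQuandleType) : {set {set Q}} :=
  [set orbit 'P (Inn Q) x | x : Q].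

Definition qdim (Q : finQuandleType) : nat :=
  \max_(S : subquandle Q) #|pi0 (sq_carrier S)|.

(* Main.v *)
Require Import Defs.
From HB Require Import structures.
From mathcomp Require Import all_boot all_fingroup.

(**
The number of components of a quandle is the largest number of values of a
function that is constant under all left translations.  For sub-quandles
S of Q and T of R, pairs of components give such a function on S x T, whence
">=".  Conversely, let S be a sub-quandle of Q x R with first projection A.
Every component of S lying over the component of a in A meets the fibre
{r | (a, r) in S}, which is a sub-quandle of R whose components each lie in a
single component of S; so at most dim R components of S lie over each of
the at most dim Q components of A.
*)

Set Implicit Arguments.
Unset Strict Implicit.
Unset Printing Implicit Defensive.

Section Orbits.
Variable Q : finQuandleType.
Implicit Types (x y : Q) (K : {set Q}).

Lemma orbit_qop x y :
  orbit 'P (Inn Q) (x |> y) = orbit 'P (Inn Q) y.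
Proof.
apply/eqP; rewrite orbit_eq_mem; apply/orbitP; exists (qperm x).
  by apply: mem_gen; apply: imset_f.
by rewrite /= /aperm permE.
Qed.

(** Each generator [qperm y] maps [K] into itself, hence lies in the setwise stabiliser of [K]; so
    the whole group [Inn Q] preserves [K]. *)
Lemma orbit_sub_stable K x :
  (forall y z, z \in K -> y |> z \in K) -> x \in K ->
  orbit 'P (Inn Q) x \subset K.
Proof.
move=> stabK Kx; rewrite acts_sub_orbit // gen_subG.
apply/subsetP => _ /imsetP[y _ ->]; rewrite !inE /=.
by apply/subsetP => z Kz; rewrite inE /= /aperm permE stabK.
Qed.

End Orbits.

Section Components.
Variable Q : finQuandleType.
Implicit Types (S : subquandle Q) (x y : Q) (K : {set Q}).

Lemma sq_mem_qop S x y : x \in sq_set S -> y \in sq_set S -> x |> y \in sq_set S.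
Proof. by move=> Sx Sy; apply: (forall_inP (forall_inP (sq_closed S) x Sx)). Qed.

Definition qinvariant (T : Type) S (f : Q -> T) :=
  {in sq_set S &, forall x y, f (x |> y) = f y}.

(* The component of [x] in [S], with the junk value [set0] when [x] is not in [S]. *)
Definition component S x : {set sq_carrier S} :=
  if insub x is Some u then orbit 'P (Inn (sq_carrier S)) u else set0.

Lemma component_val S (u : sq_carrier S) :
  component S (val u) = orbit 'P (Inn (sq_carrier S)) u.
Proof. by rewrite /component valK. Qed.

Lemma component_qinvariant S : qinvariant S (component S).
Proof.
move=> x y Sx Sy.
have -> : x |> y = val ((Sub x Sx : sq_carrier S) |> Sub y Sy) by [].
by rewrite component_val orbit_qop -component_val.
Qed.

Lemma component_imset S : component S @: sq_set S = pi0 (sq_carrier S).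
Proof.
apply/setP => O; apply/imsetP/imsetP => [[x Sx ->]|[u _ ->]].
  by exists (Sub x Sx) => //; rewrite -component_val.
by exists (val u); rewrite ?component_val //; apply: valP.
Qed.

(** Transfers [orbit_sub_stable] from the carrier of [S] to subsets of [Q], so that later arguments
    can avoid the subtype. *)
Lemma component_stable S K x y :
    (forall z t, z \in sq_set S -> t \in K -> z |> t \in K) ->
    x \in sq_set S -> y \in sq_set S -> component S x = component S y ->
  x \in K -> y \in K.
Proof.
move=> stabK Sx Sy eq_xy Kx.
pose u : sq_carrier S := Sub x Sx; pose v : sq_carrier S := Sub y Sy.
have /subsetP/(_ v) : orbit 'P (Inn (sq_carrier S)) u \subset [set w | val w \in K].
  apply: orbit_sub_stable => [w t|]; rewrite !inE //.
  exact/stabK/valP.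
rewrite inE; apply.
by rewrite -component_val /= eq_xy -[y]/(val v) component_val orbit_refl.
Qed.

(** An invariant [f] factors through [component S], so it takes at most as many values as there are
    components. *)
Lemma card_qinvariant (T : finType) S (f : Q -> T) :
  qinvariant S f -> #|f @: sq_set S| <= #|pi0 (sq_carrier S)|.
Proof.
move=> fP; rewrite -component_imset.
(* [g] is the factor map: it evaluates [f] at a chosen point of the component. The option type
   supplies a value at sets that are not components. *)
pose g O := if [pick x in sq_set S | component S x == O] is Some x
            then Some (f x) else None.
have Some_inj : injective (@Some T) by move=> ? ? [].
rewrite -(card_imset _ Some_inj).
apply: leq_trans (leq_imset_card g _); apply: subset_leq_card.
apply/subsetP => _ /imsetP[_ /imsetP[x Sx ->] ->].
apply/imsetP; exists (component S x); first exact: imset_f.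
rewrite /g; case: pickP => [y /andP[Sy /eqP eq_yx] | /(_ x)]; last by rewrite Sx eqxx.
(* The choice of point is harmless: the level sets of [f] in [S] are stable under translations by
   [S]. *)
suff: y \in [set z in sq_set S | f z == f x] by rewrite inE => /andP[_ /eqP->].
apply: (component_stable (S := S) (x := x)) => //; last by rewrite inE Sx /=.
move=> z t Sz; rewrite !inE => /andP[St /eqP eq_tx].
by rewrite sq_mem_qop // fP // eq_tx /=.
Qed.

Lemma card_pi0_le_qdim S : #|pi0 (sq_carrier S)| <= qdim Q.
Proof. exact: (leq_bigmax (F := fun S => #|pi0 (sq_carrier S)|)). Qed.

Lemma card_qinvariant_le_qdim (T : finType) S (f : Q -> T) :
  qinvariant S f -> #|f @: sq_set S| <= qdim Q.
Proof. by move/card_qinvariant/leq_trans; apply; apply: card_pi0_le_qdim. Qed.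

(** The empty sub-quandle makes the index type of the maximum inhabited, so that the maximum is
    attained. *)
Lemma subquandle0_proof : qclosed (set0 : {set Q}).
Proof. by apply/forall_inP => x; rewrite inE. Qed.

Lemma qdim_witness : exists S, qdim Q = #|pi0 (sq_carrier S)|.
Proof.
have card_gt0 : 0 < #|{: subquandle Q}|.
  by apply/card_gt0P; exists (Subquandle subquandle0_proof).
have [S eq_S] := eq_bigmax (fun S : subquandle Q => #|pi0 (sq_carrier S)|) card_gt0.
by exists S; apply: eq_S.
Qed.

End Components.

Section Product.
Variables Q R : finQuandleType.

Lemma qclosed_setX (S : subquandle Q) (T : subquandle R) :
  qclosed (setX (sq_set S) (sq_set T)).
Proof.
apply/forall_inP => -[x y] /setXP[Sx Ty]; apply/forall_inP => -[x' y'] /setXP[Sx' Ty'].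
by rewrite inE /= !sq_mem_qop.
Qed.

Lemma qdim_prod_ge : qdim Q * qdim R <= qdim (Q * R)%type.
Proof.
have [S ->] := qdim_witness Q; have [T ->] := qdim_witness R.
rewrite -!component_imset -cardsX.
(* On the product of [S] and [T], the image of [f] contains every pair of components. *)
pose f (u : Q * R) := (component S u.1, component T u.2).
have fP : qinvariant (Subquandle (qclosed_setX S T)) f.
  move=> [x y] [x' y'] /setXP[Sx Ty] /setXP[Sx' Ty'].
  by congr (_, _); apply: component_qinvariant.
apply: leq_trans (card_qinvariant_le_qdim fP); apply: subset_leq_card.
apply/subsetP => -[_ _] /setXP[/imsetP[x Sx ->] /imsetP[y Ty ->]].
by apply/imsetP; exists (x, y); rewrite ?inE ?Sx.
Qed.

Variable S : subquandle (Q * R)%type.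

Lemma qclosed_fst : qclosed (fst @: sq_set S).
Proof.
apply/forall_inP => _ /imsetP[u Su ->]; apply/forall_inP => _ /imsetP[v Sv ->].
by apply/imsetP; exists (u |> v); rewrite ?sq_mem_qop.
Qed.

(** Idempotence [a |> a = a] keeps the first coordinate fixed. *)
Lemma qclosed_fibre a : qclosed [set r | (a, r) \in sq_set S].
Proof.
apply/forall_inP => r; rewrite inE => Sr; apply/forall_inP => t; rewrite !inE => St.
by have := sq_mem_qop Sr St; rewrite /qop /= /prod_qop /= qopxx.
Qed.

(** Translations by points of the first projection lift to [S], so the projection [K] of the
    component of [u] is stable under them. Containing [u.1], it contains the whole component of
    [u.1], in particular [a]. *)
Lemma component_meets_fibre a u :
    (a \in fst @: sq_set S) -> u \in sq_set S ->
    component (Subquandle qclosed_fst) u.1 = component (Subquandle qclosed_fst) a ->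
  exists2 r, (a, r) \in sq_set S & component S (a, r) = component S u.
Proof.
move=> Aa Su eq_ua.
pose K := fst @: [set v in sq_set S | component S v == component S u].
suff /imsetP[[b r]] : a \in K.
  by rewrite inE => /andP[Sv /eqP eq_vu] /= ->; exists r.
apply: (component_stable (S := Subquandle qclosed_fst) _ _ Aa eq_ua).
- move=> _ _ /imsetP[v Sv ->] /imsetP[w + ->]; rewrite inE => /andP[Sw /eqP eq_wu].
  apply/imsetP; exists (v |> w) => //.
  by rewrite inE sq_mem_qop // component_qinvariant // eq_wu /=.
- exact: imset_f.
- by apply: imset_f; rewrite inE Su /=.
Qed.

Lemma card_component_over c :
  c \in component (Subquandle qclosed_fst) @: (fst @: sq_set S) ->
  #|component S @: [set u in sq_set S | component (Subquandle qclosed_fst) u.1 == c]|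
    <= qdim R.
Proof.
case/imsetP=> a Aa ->.
(* By [component_meets_fibre], the values of [h] on the fibre over [a] include all the components to
   be counted. *)
pose h r := component S (a, r).
have hP : qinvariant (Subquandle (qclosed_fibre a)) h.
  move=> r t; rewrite !inE => Sr St; rewrite /h -(component_qinvariant Sr St).
  by rewrite [X in _ = component _ X]/qop /= /prod_qop /= qopxx.
apply: leq_trans (card_qinvariant_le_qdim hP); apply: subset_leq_card.
apply/subsetP => _ /imsetP[u + ->]; rewrite inE => /andP[Su /eqP eq_ua].
have [r Sr <-] := component_meets_fibre Aa Su eq_ua.
by apply/imsetP; exists r; rewrite ?inE.
Qed.

Lemma card_pi0_prod_le : #|pi0 (sq_carrier S)| <= qdim Q * qdim R.
Proof.
pose A := Subquandle qclosed_fst.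
pose over c := component S @: [set u in sq_set S | component A u.1 == c].
have cover_over :
    component S @: sq_set S \subset \bigcup_(c in component A @: sq_set A) over c.
  apply/subsetP => _ /imsetP[u Su ->]; apply/bigcupP; exists (component A u.1).
    by do 2!apply: imset_f.
  by apply: imset_f; rewrite inE Su /=.
rewrite -component_imset; apply: leq_trans (subset_leq_card cover_over) _.
apply: (@leq_trans (\sum_(c in component A @: sq_set A) qdim R)).
  elim/big_rec2: _ => [|c n X Ac le_Xn]; first by rewrite cards0.
  apply: leq_trans (leq_card_setU _ _) _.
  by rewrite leq_add ?card_component_over.
(* The number of summands is bounded by applying the counting lemma to [component A] itself. *)
rewrite sum_nat_const leq_mul2r card_qinvariant_le_qdim ?orbT //.
exact: component_qinvariant.
Qed.

End Product.

Theorem theorem5p8 (Q R : finQuandleType) :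
  qdim (Q * R)%type = qdim Q * qdim R.
Proof.
apply/eqP; rewrite eqn_leq qdim_prod_ge andbT.
by apply/bigmax_leqP => S _; apply: card_pi0_prod_le.
Qed.
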